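(* Let $n\geq 2$ and let $X$ be a symmetric $n\times n$ matrix with $x_{i,i}=0$ for all $i$ and $x_{i,j}=x_{j,i}\in\{\pm 1\}$ for all $i\neq j$. The spindle algorithm described in the context, applied to $X$, is correct: (a) If the algorithm is successful, i.e. it stops by outputting $\sigma$ and $\gamma$, then $\sigma$ and $\gamma$ are permutations of $\{1,\dots,n\}$, the linking matrix of the spindle-permutation $\sigma$ is in the switching class of $X$, and $\gamma$ yields a conjugation between the two matrices. More precisely, after the normalization of $X$ in the initialization step (so that $x_{1,i}=x_{i,1}=1$ for $2\leq i\leq n$), $$x_{\gamma(i),\gamma(j)}=\mathrm{sign}\big((i-j)(\sigma(i)-\sigma(j))\big)\qquad\text{for all } 1\leq i,j\leq n .$$ (b) If the algorithm fails, i.e. it stops with the output ``no spindle structure exists for this switching class'', then there is no permutation of $\{1,\dots,n\}$ whose linking matrix is in the switching class of $X$. Moreover, the algorithm always stops with one of these two outputs. Thus it constructs a spindle-permutation with linking matrix in the switching class of $X$, or proves non-existence of such a permutation.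
   Context: Notation: $\mathrm{sign}(0)=0$ and $\mathrm{sign}(x)=x/|x|$ for $x\neq0$. Two symmetric $n\times n$ matrices $X,Y$ with zero diagonal and off-diagonal coefficients in $\{\pm1\}$ are switching-equivalent if $Y=D\,P^t\,X\,P\,D$ for a permutation matrix $P$ and a diagonal matrix $D$ with diagonal entries in $\{\pm1\}$; the equivalence classes are called switching classes. A spindle-permutation is a permutation $\sigma$ of $\{1,\dots,n\}$; its linking matrix is the matrix with $(i,j)$ entry $\mathrm{sign}((i-j)(\sigma(i)-\sigma(j)))$. The spindle algorithm on input $X$: Initialization. Conjugate $X$ by the diagonal matrix with diagonal coefficients $(1,x_{1,2},x_{1,3},\dots,x_{1,n})$; the resulting matrix is again denoted $X=(x_{i,j})$. Set $\gamma(1)=\gamma(2)=1$, $\sigma(1)=1$ and $k=2$. Main loop. Replace $\gamma(k)$ by $\gamma(k)+1$ and set $$\sigma(k)=1+\sharp\{j\mid x_{\gamma(k),j}=-1\}+\sum_{s=1}^{k-1}x_{\gamma(s),\gamma(k)}.$$ Check the following conditions: (1) $\gamma(k)\neq\gamma(s)$ for all $s\in\{1,\dots,k-1\}$; (2) $x_{\gamma(k),\gamma(s)}=\mathrm{sign}(\sigma(k)-\sigma(s))$ for all $s\in\{1,\dots,k-1\}$; (3) for all $j\in\{1,\dots,n\}\setminus\{\gamma(1),\dots,\gamma(k)\}$ and all $s\in\{1,\dots,k-1\}$: if $x_{j,\gamma(s)}\,x_{\gamma(s),\gamma(k)}=-1$, then $x_{j,\gamma(k)}=x_{j,\gamma(s)}$.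 If all three conditions are fulfilled: if $k=n$, output $i\mapsto\sigma(i)$ and $i\mapsto\gamma(i)$ and stop; if $k<n$, set $\gamma(k+1)=1$, replace $k$ by $k+1$ and iterate the main loop. If at least one condition is not fulfilled: while $\gamma(k)=n$, replace $k$ by $k-1$. Then, if $k=1$, output ``no spindle structure exists for this switching class'' and stop; if $k>1$, iterate the main loop. *)

(* Defs.v *)
From mathcomp Require Import all_boot all_order all_fingroup all_algebra.

Set Implicit Arguments.
Unset Strict Implicit.
Unset Printing Implicit Defensive.

Import Order.TTheory GRing.Theory Num.Theory.
Local Open Scope ring_scope.

Definition is_sign (x : int) : Prop := x = 1 \/ x = -1.

Definition switching_matrix n (X : 'M[int]_n) : Prop :=
  [/\ forall i j, X i j = X j i,
      forall i, X i i = 0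
    & forall i j, i != j -> is_sign (X i j)].

Definition switching_by n (p : 'S_n) (X Y : 'M[int]_n) : Prop :=
  exists2 d : 'rV[int]_n, (forall i, is_sign (d 0 i))
    & Y = diag_mx d *m (perm_mx p)^T *m X *m perm_mx p *m diag_mx d.

Definition switching_equiv n (X Y : 'M[int]_n) : Prop :=
  exists p : 'S_n, switching_by p X Y.

(* 'I_n is {0, .., n-1}, but both factors are differences, so they do not
   change under the shift to {1, .., n}. *)
Definition linking_matrix n (s : 'S_n) : 'M[int]_n :=
  \matrix_(i, j) Num.sg (((i : nat)%:Z - (j : nat)%:Z) *
                         ((s i : nat)%:Z - (s j : nat)%:Z)).

(* x_{i,j} with indices in {1, .., n}; it is 0 when an index is out of range,
   which never happens in a run of the algorithm. *)
Definition entry n (X : 'M[int]_n) (i j : nat) : int :=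
  \sum_(a < n | a.+1 == i) \sum_(b < n | b.+1 == j) X a b.

Definition normalize n (X : 'M[int]_n) : 'M[int]_n :=
  let d := \row_(j < n) if val j == 0%N then 1 else entry X 1 j.+1 in
  diag_mx d *m X *m diag_mx d.

(* A configuration is either a control point together with the current values
   of k, gamma and sigma, or a final output.  [BackTrack] is the entry of the
   loop "while gamma(k) = n, replace k by k-1".  The functions gamma and sigma
   are meaningful only on the positions assigned so far, within {1, .., n}. *)
Inductive config : Type :=
  | MainLoop (k : nat) (gamma : nat -> nat) (sigma : nat -> int)
  | BackTrack (k : nat) (gamma : nat -> nat) (sigma : nat -> int)
  | Success (sigma : nat -> int) (gamma : nat -> nat)
  | Failure.

Section Algorithm.

(* x is the normalized matrix, with indices in {1, .., n}. *)
Variables (n : nat) (x : nat -> nat -> int).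

Definition sigma_value (k : nat) (gamma : nat -> nat) : int :=
  1 + (count (fun j => x (gamma k) j == -1) (index_iota 1 n.+1))%:Z
    + \sum_(1 <= s < k) x (gamma s) (gamma k).

Definition condition1 (k : nat) (gamma : nat -> nat) : bool :=
  all (fun s => gamma k != gamma s) (index_iota 1 k).

Definition condition2 (k : nat) (gamma : nat -> nat) (sigma : nat -> int) :=
  all (fun s => x (gamma k) (gamma s) == Num.sg (sigma k - sigma s))
      (index_iota 1 k).

Definition condition3 (k : nat) (gamma : nat -> nat) : bool :=
  all (fun j => all (fun s =>
           (x j (gamma s) * x (gamma s) (gamma k) == -1) ==>
           (x j (gamma k) == x j (gamma s)))
         (index_iota 1 k))
      [seq j <- index_iota 1 n.+1
         | j \notin [seq gamma s | s <- index_iota 1 k.+1]].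

Definition step (c : config) : config :=
  match c with
  | MainLoop k gamma0 sigma0 =>
      let gamma := [eta gamma0 with k |-> (gamma0 k).+1] in
      let sigma := [eta sigma0 with k |-> sigma_value k gamma] in
      if [&& condition1 k gamma, condition2 k gamma sigma
           & condition3 k gamma]
      then if k == n then Success sigma gamma
           else MainLoop k.+1 [eta gamma with k.+1 |-> 1%N] sigma
      else BackTrack k gamma sigma
  | BackTrack k gamma sigma =>
      if gamma k == n then BackTrack k.-1 gamma sigma
      else if k == 1%N then Failure
      else MainLoop k gamma sigma
  | Success _ _ | Failure => c
  end.

(* gamma(1) = gamma(2) = 1, sigma(1) = 1, k = 2; other values are junk. *)
Definition initial : config := MainLoop 2 (fun=> 1%N) (fun=> 1).

End Algorithm.

(* Run on input X, the spindle algorithm reaches c after finitely many steps.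
   For c an output, which [step] fixes, this means that it stops with c. *)
Definition spindle_reaches n (X : 'M[int]_n) (c : config) : Prop :=
  exists m : nat, iter m (step n (entry (normalize X))) initial = c.

(* Main.v *)
Require Import Defs.
From mathcomp Require Import all_boot all_order all_fingroup all_algebra.
From mathcomp Require Import zify ring.

Set Implicit Arguments.
Unset Strict Implicit.
Unset Printing Implicit Defensive.

Import Order.TTheory GRing.Theory Num.Theory.
Local Open Scope ring_scope.

(* A linking matrix determines the values of its permutation: sigma(k) - 1
   counts the j with sigma(j) < sigma(k); for j > k these have sign -1 and for
   j < k they have sign 1, which is what the formula of the algorithm computes
   from the prefix gamma(1), .., gamma(k) alone. Hence the three conditions
   hold along any spindle structure with gamma(1) = sigma(1) = 1, and the
   backtracking search never discards one; condition (3) says that a value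
   lying between two others compares with both in opposite ways. Conversely,
   conditions (1) and (2) alone, for all k, already say that gamma conjugates
   x to the linking matrix of sigma. *)

(** * Signs, switching and normalization *)

Lemma is_signM (a b : int) : is_sign a -> is_sign b -> is_sign (a * b).
Proof. by case=> -> [] ->; [left | right | right | left]. Qed.

Lemma is_sign_sqr (a : int) : is_sign a -> a * a = 1.
Proof. by case=> ->. Qed.

Lemma switching_byE n (p : 'S_n) (d : 'rV[int]_n) (X : 'M[int]_n) (i j : 'I_n) :
  (diag_mx d *m (perm_mx p)^T *m X *m perm_mx p *m diag_mx d) i j =
  d 0 i * X ((p^-1)%g i) ((p^-1)%g j) * d 0 j.
Proof.
have colE (A : 'M[int]_n) : A *m perm_mx p = col_perm p^-1%g A.
  by rewrite col_permE invgK.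
rewrite colE tr_perm_mx -[_ *m perm_mx _ *m X]mulmxA -row_permE.
by rewrite mul_mx_diag mul_diag_mx !mxE.
Qed.

Lemma entryE n (X : 'M[int]_n) (i j : 'I_n) : entry X i.+1 j.+1 = X i j.
Proof. by rewrite /entry (big_pred1 i) // (big_pred1 j). Qed.

(** The diagonal of the normalizing conjugation. Index [ord0] gets 1 because the diagonal entry
    there is 0 for a switching matrix, hence not a sign. *)
Definition normal_sign n (X : 'M[int]_n.+1) (j : 'I_n.+1) : int :=
  if j == ord0 then 1 else X ord0 j.

Lemma normalizeE n (X : 'M[int]_n.+1) i j :
  normalize X i j = normal_sign X i * X i j * normal_sign X j.
Proof.
by rewrite /normalize mul_mx_diag mxE mul_diag_mx !mxE !(entryE X ord0).
Qed.

Lemma normal_signP n (X : 'M[int]_n.+1) j :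
  switching_matrix X -> is_sign (normal_sign X j).
Proof.
case=> _ _ Xs; rewrite /normal_sign; case: eqP => [_|/eqP nj]; first by left.
by apply: Xs; rewrite eq_sym.
Qed.

Definition normalized n (Y : 'M[int]_n.+1) : Prop :=
  switching_matrix Y /\ forall j, j != ord0 -> Y ord0 j = 1.

Lemma normalize_normalized n (X : 'M[int]_n.+1) :
  switching_matrix X -> normalized (normalize X).
Proof.
move=> hX; have [Xsym X0 Xs] := hX; split; first split=> [i j|i|i j nij].
- rewrite !normalizeE Xsym; ring.
- by rewrite normalizeE X0 mulr0 mul0r.
- rewrite normalizeE; apply: is_signM; last exact: normal_signP.
  by apply: is_signM; [exact: normal_signP | exact: Xs].
move=> j nj; rewrite normalizeE /normal_sign eqxx (negPf nj) mul1r.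
by apply: is_sign_sqr; apply: Xs; rewrite eq_sym.
Qed.

(** * Linking matrices under cyclic rotation *)

Lemma sgz_sub_nat (u v : nat) :
  Num.sg (u%:Z - v%:Z) = if (u < v)%N then -1 else if u == v then 0 else 1.
Proof.
case: (ltngtP u v) => h.
- by rewrite ltr0_sg // subr_lt0 ltz_nat.
- by rewrite gtr0_sg // subr_gt0 ltz_nat.
- by rewrite h subrr sgr0.
Qed.

Lemma linking_matrixE n (s : 'S_n) i j :
  linking_matrix s i j =
  Num.sg ((i : nat)%:Z - (j : nat)%:Z) *
  Num.sg ((s i : nat)%:Z - (s j : nat)%:Z).
Proof. by rewrite mxE sgrM. Qed.

Definition cyclic_sign n (a i : 'I_n) : int := if (a <= i)%N then 1 else -1.

Lemma val_subZp n (a i : 'I_n.+1) :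
  val (i - a) = (if (a <= i) then i - a else i + n.+1 - a)%N.
Proof.
have ha := ltn_ord a; have hi := ltn_ord i.
rewrite /= modnDmr; case: leqP => h.
  by rewrite addnBA; [rewrite -addnBAC // modnDr modn_small //; lia | lia].
by rewrite addnBA; [rewrite modn_small //; lia | lia].
Qed.

(** Rotation by [a] keeps the order of two indices on the same side of [a] and reverses it when
    exactly one of them wraps around; the two cyclic signs record this. *)
Lemma sg_sub_cyclic n (a i j : 'I_n.+1) :
  Num.sg ((val (i - a)%R)%:Z - (val (j - a)%R)%:Z) =
  cyclic_sign a i * cyclic_sign a j * Num.sg ((i : nat)%:Z - (j : nat)%:Z).
Proof.
have ha := ltn_ord a; have hi := ltn_ord i; have hj := ltn_ord j.
rewrite !sgz_sub_nat !val_subZp /cyclic_sign.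
by case: (leqP a i) => ai; case: (leqP a j) => aj; do 4?case: ifP => ?; lia.
Qed.

Definition spindle n (Y : 'M[int]_n.+1) (g s : 'S_n.+1) : Prop :=
  g ord0 = ord0 /\ forall i j, Y (g i) (g j) = linking_matrix s i j.

(* Rotating the positions and the values of a spindle-permutation cyclically
   changes its linking matrix by switchings, so the vertex 1 may be moved to
   position 1 and value 1; the first row then fixes all the signs. *)
Lemma switching_equiv_spindle n (X : 'M[int]_n.+1) (s : 'S_n.+1) :
  switching_matrix X -> switching_equiv X (linking_matrix s) ->
  exists g t, spindle (normalize X) g t.
Proof.
move=> hX [p [d ds E]].
have [_ Y0] := normalize_normalized hX.
(* [a] is the position of vertex 1 in the linking matrix of [s]; shifting positions by [a] and
   values by [s a] brings both to 0. *)
pose a := p ord0; pose q := (p^-1)%g.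
have qa : q a = ord0 by rewrite /q /a permK.
have injg : injective (fun i => q (i + a)) by move=> i j /perm_inj/addIr.
have injt : injective (fun i => s (i + a) - s a).
  by move=> i j /addIr/perm_inj/addIr.
pose g := perm injg; pose t := perm injt.
have g0 : g ord0 = ord0 by rewrite permE -[ord0]/(0 : 'I_n.+1) add0r.
have t0 : t ord0 = ord0.
  by rewrite permE -[ord0]/(0 : 'I_n.+1) add0r subrr.
(* The product of all signs met at position [i]: wrapping of the position, wrapping of the value,
   the given diagonal, and the normalization. *)
pose e i := cyclic_sign a (i + a) * cyclic_sign (s a) (s (i + a)) *
            d 0 (i + a) * normal_sign X (g i).
have es i : is_sign (e i).
  do 3?[apply: is_signM]; [| | exact: ds | exact: normal_signP];
  by rewrite /cyclic_sign; case: ifP; [left | right].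
have main i j : linking_matrix t i j = e i * e j * normalize X (g i) (g j).
  have Xgg : X (g i) (g j) =
    normal_sign X (g i) * normalize X (g i) (g j) * normal_sign X (g j).
    have /is_sign_sqr hi := normal_signP (g i) hX.
    have /is_sign_sqr hj := normal_signP (g j) hX.
    by rewrite normalizeE !mulrA hi mul1r -mulrA hj mulr1.
  have Lij : linking_matrix s (i + a) (j + a) =
             d 0 (i + a) * X (g i) (g j) * d 0 (j + a).
    by rewrite E switching_byE !permE.
  have ti k : t k = s (k + a) - s a by rewrite permE.
  (* The values are already differences with [s a]; the positions are written as [(i + a) - a] so
     that the same rotation rule applies to them. *)
  rewrite linking_matrixE !ti sg_sub_cyclic -{1}(addrK a i) -{1}(addrK a j).
  rewrite sg_sub_cyclic.
  have := Lij; rewrite linking_matrixE Xgg /e.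
  move: (normalize X _ _) (normal_sign X _) (normal_sign X _).
  move: (Num.sg _) (Num.sg _) => w1 w2 y h1 h2 H.
  rewrite mulrACA H.
  ring.
(* Both matrices have only ones in row [ord0] off the diagonal, so every [e j] equals [e ord0]. *)
have e0 j : e ord0 * e j = 1.
  have [->|nj] := eqVneq j ord0; first exact: is_sign_sqr.
  have := main ord0 j; rewrite g0 Y0 => [|]; last first.
    by rewrite -g0 (inj_eq perm_inj).
  rewrite mulr1 => <-; rewrite linking_matrixE t0 !sgz_sub_nat /=.
  have -> : (0 < j)%N by rewrite lt0n.
  suff -> : (0 < t j)%N by [].
  by rewrite lt0n -[0%N]/(val (ord0 : 'I_n.+1)) -t0 val_eqE (inj_eq perm_inj).
exists g, t; split=> // i j; rewrite main.
suff -> : e i * e j = 1 by rewrite mul1r.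
rewrite -[LHS]mul1r -(is_sign_sqr (es ord0)) mulrACA !e0; ring.
Qed.

(** * The formula for sigma as a rank *)

(** Integer values replace a permutation, because the computed [sigma] has to be compared with [Y]
    before it is known to be one. *)
Definition linking_entry n (f : 'I_n -> int) (i j : 'I_n) : int :=
  Num.sg (((i : nat)%:Z - (j : nat)%:Z) * (f i - f j)).

(* For each j, the two contributions on the left add up to [f j < f i]. *)
Lemma linking_rank n (f : 'I_n -> int) (i : 'I_n) : injective f ->
  #|[pred j | linking_entry f i j == -1]|%:Z +
    \sum_(j < n | (j < i)%N) linking_entry f j i = #|[pred j | f j < f i]|%:Z.
Proof.
move=> injf; rewrite -!sum1_card !(big_morph Posz PoszD (erefl _)).
rewrite big_mkcond /=.
rewrite [in X in _ + X]big_mkcond [RHS]big_mkcond /= -big_split /=.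
apply: eq_bigr => j _; rewrite !inE /linking_entry !sgrM !sgz_sub_nat.
have [ij|ji|/val_inj ->] := ltngtP i j; last by rewrite mul0r ltxx.
- rewrite mulN1r addr0 eqr_opp; case: sgrP => h.
  + by move/eqP: h ij; rewrite subr_eq0 => /eqP/injf ->; rewrite ltnn.
  + by move: h; rewrite subr_gt0 => ->.
  + by move: h; rewrite subr_lt0 => /lt_gtF ->.
- rewrite mulN1r mul1r -(opprB (f i) (f j)) sgrN opprK; case: sgrP => h.
  + by move/eqP: h ji; rewrite subr_eq0 => /eqP/injf ->; rewrite ltnn.
  + by move: h; rewrite subr_gt0 => ->.
  + by move: h; rewrite subr_lt0 => /lt_gtF ->.
Qed.

(** The count over vertices becomes a count over positions by reindexing along [g], while the sum
    only sees the prefix. *)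
Lemma sigma_valueE n (Y : 'M[int]_n) (g : 'S_n) gamma (i : 'I_n) :
  (forall j : 'I_n, (j <= i)%N -> gamma j.+1 = (g j).+1) ->
  sigma_value n (entry Y) i.+1 gamma =
  1 + #|[pred j | Y (g i) (g j) == -1]|%:Z +
  \sum_(j < n | (j < i)%N) Y (g j) (g i).
Proof.
move=> H; rewrite /sigma_value (H i) //; congr (1 + _%:Z + _).
  rewrite -sum1_count big_add1 /= big_mkord -sum1_card.
  by rewrite (reindex_inj (@perm_inj _ g)); apply: eq_bigl => j; rewrite entryE.
rewrite big_add1 /= big_mkord.
rewrite (big_ord_widen n (fun t => entry Y (gamma t.+1) (g i).+1)) 1?ltnW //.
by apply: eq_bigr => j ji; rewrite H 1?ltnW // entryE.
Qed.

Lemma card_perm_lt n (s : 'S_n) (i : 'I_n) : #|[pred j | (s j < s i)%N]| = s i.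
Proof.
have lsi := ltn_ord (s i).
rewrite -[RHS]card_ord -[RHS]sum1_card (big_ord_widen n (fun=> 1%N)) 1?ltnW //.
by rewrite -sum1_card [RHS](reindex_inj (@perm_inj _ s)).
Qed.

Lemma spindle_sigma_value n (Y : 'M[int]_n.+1) (g s : 'S_n.+1) gamma
    (i : 'I_n.+1) :
  spindle Y g s ->
  (forall j : 'I_n.+1, (j <= i)%N -> gamma j.+1 = (g j).+1) ->
  sigma_value n.+1 (entry Y) i.+1 gamma = (s i).+1%:Z.
Proof.
move=> [_ L] H; rewrite (sigma_valueE _ H) -addrA.
pose f (j : 'I_n.+1) := (s j : nat)%:Z.
have injf : injective f by move=> a b [] /val_inj/perm_inj.
have Lf a b : Y (g a) (g b) = linking_entry f a b by rewrite L mxE.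
rewrite (eq_card (B := [pred j | linking_entry f i j == -1])); last first.
  by move=> j; rewrite !inE Lf.
under eq_bigr do rewrite Lf.
by rewrite linking_rank // (card_perm_lt s i).
Qed.

(** * The three conditions along a spindle structure *)

Lemma succ_ordP n t : (1 <= t <= n)%N -> exists i : 'I_n, t = i.+1.
Proof. by case: t => [//|t] lt_tn; exists (Ordinal lt_tn). Qed.

Lemma spindle_conditions n (Y : 'M[int]_n.+1) (g s : 'S_n.+1) gamma sigma
    (k : 'I_n.+1) :
  spindle Y g s ->
  (forall j : 'I_n.+1, (j <= k)%N -> gamma j.+1 = (g j).+1) ->
  (forall j : 'I_n.+1, (j <= k)%N ->
     sigma j.+1 = sigma_value n.+1 (entry Y) j.+1 gamma) ->
  [&& condition1 k.+1 gamma, condition2 (entry Y) k.+1 gamma sigma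
    & condition3 n.+1 (entry Y) k.+1 gamma].
Proof.
move=> sp Hg Hs; have [_ L] := sp.
have sE (j : 'I_n.+1) : (j <= k)%N -> sigma j.+1 = (s j).+1%:Z.
  move=> jk; rewrite Hs //; apply: (spindle_sigma_value sp) => i ij.
  by apply: Hg; apply: leq_trans jk.
have ltE t : t \in index_iota 1 k.+1 ->
    exists2 i : 'I_n.+1, (i < k)%N & t = i.+1.
  rewrite mem_index_iota => /andP[t0 tk].
  have [|i ti] := @succ_ordP n.+1 t.
    by rewrite t0 (leq_trans (leqnSn _) (leq_trans tk (ltn_ord k))).
  by exists i; rewrite // -ltnS -ti.
apply/and3P; split.
- apply/allP => t /ltE[i ik ->]; rewrite (Hg k) // (Hg i) 1?ltnW //.
  rewrite eqSS val_eqE.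
  by rewrite (inj_eq perm_inj) -val_eqE gtn_eqF.
- apply/allP => t /ltE[i ik ->]; rewrite (Hg k) // (Hg i) 1?ltnW //.
  rewrite entryE (sE k) // (sE i) 1?ltnW // L.
  rewrite linking_matrixE !sgz_sub_nat eqSS ltnS ltnNge (ltnW ik).
  by rewrite gtn_eqF // mul1r.
- apply/allP => j; rewrite mem_filter mem_index_iota => /andP[jn jN].
  (* [m] is the position of vertex [j]; it comes after [k] because [j] is not among the vertices
     already placed. *)
  have [j' ej] := succ_ordP jN; pose m := (g^-1)%g j'.
  have gm : g m = j' by rewrite permKV.
  have km : (k < m)%N.
    rewrite ltnNge; apply: contra jn => mk; apply/mapP; exists m.+1.
      by rewrite mem_index_iota /= !ltnS.
    by rewrite Hg // gm.
  apply/allP => t /ltE[i ik ->]; rewrite (Hg k) // (Hg i) 1?ltnW //.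
  rewrite ej -gm !entryE !L.
  (* With [i < k < m], the premise of condition (3) puts [s i] strictly between [s k] and [s m], so
     [s m] compares in the same way with both. *)
  have im := ltn_trans ik km.
  rewrite !linking_matrixE !sgz_sub_nat ik (ltnNge m) (ltnW im) (gtn_eqF im).
  rewrite (ltnNge m) (ltnW km) (gtn_eqF km) !mul1r.
  by do 8?case: ifP => ?; lia.
Qed.

(** * Dependence on the assigned prefix, and the search invariant *)

Lemma sigma_value_ext n x k gamma gamma' :
  (1 <= k)%N -> (forall i, (1 <= i <= k)%N -> gamma i = gamma' i) ->
  sigma_value n x k gamma = sigma_value n x k gamma'.
Proof.
move=> k1 E; rewrite /sigma_value E ?k1 ?leqnn //; congr (_ + _).
by apply: eq_big_nat => i /andP[i1 ik]; rewrite E // i1 ltnW.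
Qed.

Lemma condition1_ext k gamma gamma' :
  (1 <= k)%N -> (forall i, (1 <= i <= k)%N -> gamma i = gamma' i) ->
  condition1 k gamma = condition1 k gamma'.
Proof.
move=> k1 E; apply: eq_in_all => i; rewrite mem_index_iota => /andP[i1 ik].
by rewrite !E ?k1 ?leqnn // i1 ltnW.
Qed.

Lemma condition2_ext x k gamma gamma' sigma sigma' :
  (1 <= k)%N -> (forall i, (1 <= i <= k)%N -> gamma i = gamma' i) ->
  (forall i, (1 <= i <= k)%N -> sigma i = sigma' i) ->
  condition2 x k gamma sigma = condition2 x k gamma' sigma'.
Proof.
move=> k1 E F; apply: eq_in_all => i; rewrite mem_index_iota => /andP[i1 ik].
by rewrite !(E, F) ?k1 ?leqnn // i1 ltnW.
Qed.

Definition valid n (x : nat -> nat -> int) k gamma sigma : Prop :=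
  forall i, (1 <= i <= k)%N ->
    [/\ (1 <= gamma i <= n)%N, sigma i = sigma_value n x i gamma,
        condition1 i gamma & condition2 x i gamma sigma].

Lemma valid_ext n x k gamma gamma' sigma sigma' :
  (forall i, (1 <= i <= k)%N -> gamma i = gamma' i) ->
  (forall i, (1 <= i <= k)%N -> sigma i = sigma' i) ->
  valid n x k gamma sigma -> valid n x k gamma' sigma'.
Proof.
move=> E F V i ik; have /andP[i1 lik] := ik.
have E' j : (1 <= j <= i)%N -> gamma j = gamma' j.
  by case/andP=> j1 ji; apply: E; rewrite j1 (leq_trans ji).
have F' j : (1 <= j <= i)%N -> sigma j = sigma' j.
  by case/andP=> j1 ji; apply: F; rewrite j1 (leq_trans ji).
have [] := V i ik; rewrite E // F // (sigma_value_ext n x i1 E').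
by rewrite (condition1_ext i1 E') (condition2_ext x i1 E' F').
Qed.

(** * Runs of the algorithm *)

Definition reaches n x (c c' : config) : Prop :=
  exists m, iter m (step n x) c = c'.

Lemma reaches_refl n x c : reaches n x c c.
Proof. by exists 0%N. Qed.

Lemma reaches_step n x c c' : reaches n x (step n x c) c' -> reaches n x c c'.
Proof. by case=> m <-; exists m.+1; rewrite iterSr. Qed.

Lemma reaches_trans n x c c' c'' :
  reaches n x c c' -> reaches n x c' c'' -> reaches n x c c''.
Proof. by case=> m <- [m' <-]; exists (m' + m)%N; rewrite iterD. Qed.

(** Fixed configurations persist, so after the sum of the two step counts the run is in both; hence
    the output is unique. *)
Lemma reaches_final n x c c' c'' : step n x c' = c' -> step n x c'' = c'' ->
  reaches n x c c' -> reaches n x c c'' -> c' = c''.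
Proof.
have fix_iter d : step n x d = d -> forall m, iter m (step n x) d = d.
  by move=> sd; elim=> //= m ->.
move=> /fix_iter f' /fix_iter f'' [m E'] [m' E''].
by rewrite -(f' m') -E' -(f'' m) -E'' -!iterD addnC.
Qed.

(** * The backtracking search *)

Definition agrees n (k : nat) (gamma : nat -> nat) (g : 'S_n) : Prop :=
  forall i : 'I_n, (i < k)%N -> gamma i.+1 = (g i).+1.

(* In the second case, every value of gamma(k) above the initial one has been
   excluded for the given gamma(1), .., gamma(k - 1). *)
Definition search_outcome n (Y : 'M[int]_n.+1) k gamma sigma : Prop :=
  (exists sigma' gamma',
     reaches n.+1 (entry Y) (MainLoop k gamma sigma) (Success sigma' gamma') /\
     valid n.+1 (entry Y) n.+1 gamma' sigma') \/
  (exists gamma' sigma',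
     [/\ reaches n.+1 (entry Y) (MainLoop k gamma sigma)
           (BackTrack k gamma' sigma'),
         gamma' k = n.+1,
         forall i, (1 <= i < k)%N -> gamma' i = gamma i,
         forall i, (1 <= i < k)%N -> sigma' i = sigma i
       & forall (g s : 'S_n.+1), spindle Y g s -> agrees k.-1 gamma g ->
           forall i : 'I_n.+1, i.+1 = k -> ((g i).+1 <= gamma k)%N]).

(* Lexicographic induction on the remaining depth n - k and the remaining
   candidates n - gamma(k). *)
Lemma main_loop_outcome n (Y : 'M[int]_n.+1) d k gamma sigma :
  (k + d)%N = n.+1 -> (2 <= k)%N -> gamma 1%N = 1%N ->
  valid n.+1 (entry Y) k.-1 gamma sigma -> (1 <= gamma k < n.+1)%N ->
  search_outcome Y k gamma sigma.
Proof.
set x := entry Y; set N := n.+1.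
have [b] := ubnP d; elim: b => // b IHd in d k gamma sigma *.
rewrite ltnS => le_d kd k2 g1.
have [e] := ubnP (N - gamma k); elim: e => // e IHe in gamma sigma g1 *.
rewrite ltnS => le_e V /andP[gk1 gkN].
pose gam := [eta gamma with k |-> (gamma k).+1].
pose sig := [eta sigma with k |-> sigma_value N x k gam].
have stepE : step N x (MainLoop k gamma sigma) =
    if [&& condition1 k gam, condition2 x k gam sig & condition3 N x k gam]
    then if k == N then Success sig gam
         else MainLoop k.+1 [eta gam with k.+1 |-> 1%N] sig
    else BackTrack k gam sig by [].
have k1 : (1 <= k)%N by exact: ltnW.
have gamE i : (1 <= i < k)%N -> gam i = gamma i.
  by case/andP=> _ ik; rewrite /gam /= ltn_eqF.
have sigE i : (1 <= i < k)%N -> sig i = sigma i.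
  by case/andP=> _ ik; rewrite /sig /= ltn_eqF.
have gamk : gam k = (gamma k).+1 by rewrite /gam /= eqxx.
have sigk : sig k = sigma_value N x k gam by rewrite /sig /= eqxx.
have ltk i : (1 <= i <= k.-1)%N = (1 <= i < k)%N.
  by rewrite -{2}(prednK k1) ltnS.
(* Common to both rejections of the candidate [(gamma k).+1], by a failed test or by an exhausted
   subsearch at [k.+1]: either no candidate is left, or the inner induction treats the next one. *)
have retry gam' sig' :
    reaches N x (MainLoop k gamma sigma) (BackTrack k gam' sig') ->
    gam' k = (gamma k).+1 ->
    (forall i, (1 <= i < k)%N -> gam' i = gamma i) ->
    (forall i, (1 <= i < k)%N -> sig' i = sigma i) ->
    (forall (g s : 'S_N), spindle Y g s -> agrees k.-1 gamma g ->
       forall i : 'I_N, i.+1 = k -> (g i).+1 <> (gamma k).+1) ->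
    search_outcome Y k gamma sigma.
  move=> R gk' E F no.
  have [gN|gN] := eqVneq (gamma k).+1 N.
    right; exists gam', sig'; split; rewrite ?gk' //.
    move=> g s sp ag i ik; have := no g s sp ag i ik; have := ltn_ord (g i).
    by move: gN; rewrite /N; lia.
  have R' : reaches N x (MainLoop k gamma sigma) (MainLoop k gam' sig').
    apply: reaches_trans R _; apply: reaches_step; rewrite /= gk' (negPf gN).
    by rewrite (gtn_eqF k2); exact: reaches_refl.
  have [||||[s' [g' [R'' V']]]|[g' [s' [R'' gk'' E' F' no']]]] := IHe gam' sig'.
  - by rewrite E ?k2.
  - by rewrite gk'; lia.
  - by apply: valid_ext V => i; rewrite ltk => ik; rewrite ?E ?F.
  - by rewrite gk'; lia.
  - by left; exists s', g'; split=> //; apply: reaches_trans R''.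
  right; exists g', s'; split=> //.
  - exact: reaches_trans R''.
  - by move=> i ik; rewrite E' // E.
  - by move=> i ik; rewrite F' // F.
  move=> g s sp ag i ik; have neq := no g s sp ag i ik.
  have ag' : agrees k.-1 gam' g.
    by move=> j jk; rewrite E ?ag //= -(prednK k1) ltnS.
  by have := no' g s sp ag' i ik; rewrite gk' leq_eqVlt => /orP[/eqP/neq|].
have Vgam : valid N x k.-1 gam sig.
  by apply: valid_ext V => i; rewrite ltk => ik; rewrite ?gamE ?sigE.
have [C|C] := boolP [&& condition1 k gam, condition2 x k gam sig
                         & condition3 N x k gam].
- have Vk : valid N x k gam sig.
    move=> i /andP[i1]; rewrite leq_eqVlt => /orP[/eqP->|ik].
      by rewrite gamk; case/and3P: C; split; rewrite // ltnS.
    by apply: Vgam; rewrite ltk i1.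
  have [kN|kN] := eqVneq k N.
    left; exists sig, gam; split; last by rewrite kN in Vk.
    by apply: reaches_step; rewrite stepE C (introT eqP kN);
      exact: reaches_refl.
  pose gam2 := [eta gam with k.+1 |-> 1%N].
  have gam2E i : (1 <= i <= k)%N -> gam2 i = gam i.
    by case/andP=> _ ik; rewrite /gam2 /= ltn_eqF.
  have gam2k : gam2 k.+1 = 1%N by rewrite /gam2 /= eqxx.
  have R : reaches N x (MainLoop k gamma sigma) (MainLoop k.+1 gam2 sig).
    by apply: reaches_step; rewrite stepE C (negPf kN); exact: reaches_refl.
  have [||||||[s' [g' [R' V']]]|[g' [s' [R' gk' E' F' no']]]] :=
    IHd d.-1 k.+1 gam2 sig.
  + lia.
  + lia.
  + lia.
  + by rewrite gam2E ?gamE ?k2 ?k1.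
  + by apply: valid_ext Vk => i ik; rewrite ?gam2E.
  + by rewrite gam2k; lia.
  + by left; exists s', g'; split=> //; apply: reaches_trans R'.
  apply: (retry g' s').
  + apply: reaches_trans R _; apply: reaches_trans R' _; apply: reaches_step.
    by rewrite /= gk' eqxx; exact: reaches_refl.
  + by rewrite E' ?ltnSn ?k1 // gam2E ?leqnn ?k1.
  + move=> i /andP[i1 ik]; have ik' := ltnW ik.
    by rewrite E' ?i1 ?ltnS // gam2E ?i1 // gamE // i1.
  + move=> i /andP[i1 ik]; have ik' := ltnW ik.
    by rewrite F' ?i1 ?ltnS // sigE // i1.
  move=> g s sp ag i ik gi.
  have lt_kN : (k < N)%N by lia.
  have ag' : agrees k gam2 g.
    move=> j jk; rewrite gam2E ?jk //.
    have [jk'|kj|ji] := ltngtP j k.-1.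
    * by rewrite gamE ?ag //= -(prednK k1) ltnS.
    * by move: kj; rewrite -ltnS prednK // ltnS leqNgt jk.
    * have -> : j = i by apply: val_inj; rewrite /= ji -ik.
      by rewrite ik gamk.
  (* The exhausted subsearch leaves only the initial value 1 at position [k.+1], but vertex 1
     already occupies position 1. *)
  have := no' g s sp ag' (Ordinal lt_kN) erefl.
  rewrite gam2k ltnS leqn0 -[0%N]/(val (ord0 : 'I_N)) val_eqE.
  case: sp => g0 _; rewrite -{1}g0 (inj_eq perm_inj) -val_eqE /=; lia.
- apply: (retry gam sig) => //.
    by apply: reaches_step; rewrite stepE (negPf C); exact: reaches_refl.
  (* A spindle structure that continues the prefix with this candidate would pass all three
     tests. *)
  move=> g s sp ag i ik gi; case/negP: C; rewrite -ik.
  have ag' (j : 'I_N) : (j <= i)%N -> gam j.+1 = (g j).+1.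
    rewrite leq_eqVlt => /orP[/eqP/val_inj->|ji]; first by rewrite gi ik gamk.
    by rewrite gamE ?ag //= -ik ?ltnS.
  apply: (spindle_conditions sp) => // j.
  rewrite leq_eqVlt => /orP[/eqP/val_inj->|ji].
    by rewrite ik sigk.
  by have [] := Vgam j.+1; rewrite // ltk -ik.
Qed.

(** * From a completed search to a spindle structure *)

(** Condition (1) makes [gamma] injective, and condition (2) with symmetry gives the signs.
    Off-diagonal entries are nonzero, so the values of [sigma] are distinct; the formula makes each
    of them one plus its rank, hence [sigma] is a permutation. *)
Lemma valid_spindle n (Y : 'M[int]_n.+1) gamma sigma :
  switching_matrix Y -> valid n.+1 (entry Y) n.+1 gamma sigma ->
  exists g s : 'S_n.+1,
    [/\ forall i : 'I_n.+1, gamma i.+1 = (g i).+1,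
        forall i : 'I_n.+1, sigma i.+1 = (s i).+1%:Z
      & forall i j, Y (g i) (g j) = linking_matrix s i j].
Proof.
move=> [Ysym Y0 Ys] V.
have V' (i : 'I_n.+1) := V i.+1 (ltn_ord i).
pose g0 (i : 'I_n.+1) : 'I_n.+1 := inord (gamma i.+1).-1.
have g0E (i : 'I_n.+1) : gamma i.+1 = (g0 i).+1.
  by have [/andP[gi1 giN] _ _ _] := V' i; rewrite inordK ?prednK.
have g0_lt (i j : 'I_n.+1) : (j < i)%N -> g0 i != g0 j.
  move=> ji; have [_ _ /allP C1 _] := V' i.
  have := C1 j.+1; rewrite mem_index_iota /= ltnS ji => /(_ isT).
  by rewrite !g0E eqSS.
have injg : injective g0.
  move=> i j; case: (ltngtP i j) => [ij|ji|/val_inj //].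
    by move: (g0_lt _ _ ij) => /eqP h /esym /h.
  by move: (g0_lt _ _ ji) => /eqP h /h.
pose g := perm injg.
have gE (i : 'I_n.+1) : gamma i.+1 = (g i).+1 by rewrite permE.
pose f (i : 'I_n.+1) := sigma i.+1.
have Y_lt (i j : 'I_n.+1) : (j < i)%N -> Y (g i) (g j) = Num.sg (f i - f j).
  move=> ji; have [_ _ _ /allP C2] := V' i.
  have := C2 j.+1; rewrite mem_index_iota /= ltnS ji => /(_ isT) /eqP.
  by rewrite !gE entryE.
have Yf i j : Y (g i) (g j) = linking_entry f i j.
  rewrite /linking_entry sgrM sgz_sub_nat; case: ltngtP => [ij|ji|/val_inj ->].
  - by rewrite Ysym Y_lt // -opprB sgrN mulN1r.
  - by rewrite Y_lt // mul1r.
  - by rewrite Y0 mul0r.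
have injf : injective f.
  move=> i j fij; apply/eqP; apply: contraT => nij.
  have : is_sign (Y (g i) (g j)) by apply: Ys; rewrite (inj_eq perm_inj).
  by rewrite Yf /linking_entry fij subrr mulr0 sgr0; case.
pose r i := #|[pred j | f j < f i]|.
have fr i : f i = (r i).+1%:Z.
  have [_ + _ _] := V' i; rewrite -/(f i) => ->.
  rewrite (sigma_valueE _ (fun j _ => gE j)).
  rewrite -[(r i).+1%:Z]/(1 + (r i)%:Z) -addrA -linking_rank //.
  rewrite (eq_card (B := [pred j | linking_entry f i j == -1])); last first.
    by move=> j; rewrite !inE Yf.
  by under eq_bigr do rewrite Yf.
have r_lt i : (r i < n.+1)%N.
  rewrite -[X in (_ < X)%N]card_ord; apply: proper_card.
  apply/properP; split; first exact/subsetP.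
  by exists i; rewrite ?inE // ltxx.
have injs : injective (fun i => Ordinal (r_lt i)).
  by move=> i j [] rij; apply: injf; rewrite !fr rij.
exists g, (perm injs); split=> // [i|i j]; first by rewrite permE -fr.
rewrite Yf mxE !permE /linking_entry !fr /=; congr (Num.sg (_ * _)); lia.
Qed.

(** * Initialization and correctness *)

(** The first row contains no -1, so the initial value sigma(1) = 1 obeys the formula of the main
    loop and the invariant holds at the start. *)
Lemma sigma_value1 n (Y : 'M[int]_n.+1) gamma :
  normalized Y -> gamma 1%N = 1%N -> sigma_value n.+1 (entry Y) 1 gamma = 1.
Proof.
move=> [[_ Y0 _] Y1] g1; rewrite /sigma_value big_geq // addr0 g1.
rewrite (eq_in_count (a2 := pred0)) ?count_pred0 // => t.
rewrite mem_index_iota => /succ_ordP[j ->] /=; rewrite (entryE Y ord0).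
by have [->|/Y1 ->] := eqVneq j ord0; rewrite ?Y0.
Qed.

Lemma spindle_algorithm_outcome n (X : 'M[int]_n.+1) :
  (2 <= n.+1)%N -> switching_matrix X ->
  (exists sigma gamma, spindle_reaches X (Success sigma gamma) /\
     valid n.+1 (entry (normalize X)) n.+1 gamma sigma) \/
  (spindle_reaches X Failure /\ forall g s, ~ spindle (normalize X) g s).
Proof.
move=> n2 hX; have hY := normalize_normalized hX.
have V : valid n.+1 (entry (normalize X)) 1 (fun=> 1%N) (fun=> 1).
  move=> [|[|i]] // _; split=> //; first by rewrite sigma_value1.
have kd : (2 + n.-1)%N = n.+1 by lia.
have [[sigma [gamma [R W]]]|[gamma [sigma [R g2 E _ no]]]] :=
  main_loop_outcome kd (leqnn 2) erefl V n2.
  by left; exists sigma, gamma.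
right; split.
  (* Backtracking from position 2 reaches position 1, where gamma(1) = 1 differs from n, so the loop
     stops there with failure. *)
  apply: (reaches_trans R); apply: reaches_step; rewrite /= g2 eqxx.
  apply: reaches_step; rewrite /= E // ifN; first exact: reaches_refl.
  by rewrite ltn_eqF.
move=> g s sp; have [g0 _] := sp.
have ag : agrees 1 (fun=> 1%N) g.
  move=> i; rewrite ltnS leqn0 => /eqP i0.
  by rewrite (val_inj (i0 : val i = val ord0)) g0.
(* Position 2 could only carry vertex 1, which already sits at position 1. *)
have := no g s sp ag (Ordinal n2) erefl.
rewrite ltnS leqn0 -[0%N]/(val (ord0 : 'I_n.+1)) val_eqE.
by rewrite -[X in _ == X]g0 (inj_eq perm_inj).
Qed.

(** The conjugating diagonal consists of the normalization signs read along [g]. *)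
Lemma spindle_switching_by n (X : 'M[int]_n.+1) (g s : 'S_n.+1) :
  switching_matrix X ->
  (forall i j, normalize X (g i) (g j) = linking_matrix s i j) ->
  switching_by (g^-1)%g X (linking_matrix s).
Proof.
move=> hX L; exists (\row_i normal_sign X (g i)) => [i|].
  by rewrite mxE; exact: normal_signP.
by apply/matrixP => i j; rewrite switching_byE -L normalizeE !mxE invgK.
Qed.

Theorem mainTheorem2 (n : nat) (hn : (2 <= n)%N) (X : 'M[int]_n)
    (hX : switching_matrix X) :
  (* (a) *)
  (forall (sigma : nat -> int) (gamma : nat -> nat),
     spindle_reaches X (Success sigma gamma) ->
     exists s g : 'S_n,
       [/\ forall i : 'I_n, sigma i.+1 = (s i).+1%:Z,
           forall i : 'I_n, gamma i.+1 = (g i).+1,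
           switching_equiv X (linking_matrix s),
           (* (perm_mx p)^T *m X *m perm_mx p has (i, j) entry
              X (p^-1 i) (p^-1 j), hence the inverse here *)
           switching_by (g^-1)%g X (linking_matrix s)
         & forall i j : nat, (1 <= i <= n)%N -> (1 <= j <= n)%N ->
             entry (normalize X) (gamma i) (gamma j) =
             Num.sg ((i%:Z - j%:Z) * (sigma i - sigma j))]) /\
  (* (b) *)
  (spindle_reaches X Failure ->
     forall s : 'S_n, ~ switching_equiv X (linking_matrix s)) /\
  (* termination *)
  ((exists (sigma : nat -> int) (gamma : nat -> nat),
      spindle_reaches X (Success sigma gamma)) \/
   spindle_reaches X Failure).
Proof.
case: n hn X hX => // n hn X hX.
have out := spindle_algorithm_outcome hn hX.
have [hY _] := normalize_normalized hX.
split; last split.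
- move=> sigma gamma R; case: out => [[s' [g' [R' V]]]|[R' _]]; last first.
    by have := reaches_final erefl erefl R R'.
  have [es eg] : s' = sigma /\ g' = gamma.
    by have [] := reaches_final erefl erefl R' R.
  rewrite {}es {}eg {R'} in V.
  have [g [s [gE sE L]]] := valid_spindle hY V.
  have sw := spindle_switching_by hX L.
  exists s, g; split=> //; first by exists (g^-1)%g.
  move=> i j /succ_ordP[i' ->] /succ_ordP[j' ->].
  rewrite !gE !sE entryE L mxE; congr (Num.sg (_ * _)); lia.
- move=> R s /(switching_equiv_spindle hX)[g [t sp]].
  case: out => [[s' [g' [R' _]]]|[_ /(_ g t)]] //.
  by have := reaches_final erefl erefl R R'.
- case: out => [[s' [g' [R _]]]|[R _]]; last by right.
  by left; exists s', g'.
Qed.
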